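(* Let $\Gamma\rightrightarrows E$ be a groupoid (multiplication relation $m$, inverse $s$, set of units $E\subset\Gamma$) and let $\Phi$ be a group of automorphisms of $\Gamma$, i.e. each $\varphi\in\Phi$ is a bijection $\Gamma\to\Gamma$ satisfying $\varphi(E)=E$, $\varphi s=s\varphi$, $\varphi m=m(\varphi\times\varphi)$. Let $\tilde\Gamma$ be the set of orbits of $\Phi$ and $\pi:\Gamma\to\tilde\Gamma$ the canonical projection. Assume that $\Phi$ satisfies $$\forall\,\varphi\in\Phi,\ e\in E:\quad [\varphi(e)=e]\ \Rightarrow\ [\forall\,\gamma\in F_l(e)\cup F_r(e):\ \varphi(\gamma)=\gamma].$$ Then there exists a unique structure $(\tilde m,\tilde s,\tilde E)$ of a groupoid on $\tilde\Gamma$ such that the transposed relation $\pi^T$, from $\tilde\Gamma$ to $\Gamma$, is a morphism of groupoids. Moreover, $\pi^T$ is a monomorphism.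
   Context: A relation $r$ from $X$ to $Y$ is identified with its graph, a subset of $Y\times X$; its transpose $r^T$, from $Y$ to $X$, satisfies $(x,y)\in r^T\iff(y,x)\in r$. Maps are regarded as relations; relations are composed in the usual way. For a relation $h$ from $X$ to $Y$ and $D\subset X$, $h(D)=\{y:\exists x\in D,\ (y,x)\in h\}$. A groupoid $\Gamma\rightrightarrows E$ has left (target) and right (source) projections $e_L,e_R:\Gamma\to E$; a pair $(\gamma_1,\gamma_2)$ is composable iff $e_R(\gamma_1)=e_L(\gamma_2)$; the multiplication is regarded as a relation $m$ from $\Gamma\times\Gamma$ to $\Gamma$. $F_l(\gamma):=e_L^{-1}(e_L(\gamma))$ and $F_r(\gamma):=e_R^{-1}(e_R(\gamma))$ are the left and right fibers through $\gamma$. Morphisms are those of the Zakrzewski category of groupoids: a morphism from $(\Gamma_1,m_1,s_1,E_1)$ to $(\Gamma_2,m_2,s_2,E_2)$ is a relation $h$ from $\Gamma_1$ to $\Gamma_2$ with $hm_1=m_2(h\times h)$, $hs_1=s_2h$, $h(E_1)=E_2$. ''Monomorphism'' is meant in this category. *)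

(* Defs.v *)
From mathcomp Require Import all_boot.
From mathcomp Require Import boolp classical_sets.

Set Implicit Arguments.
Unset Strict Implicit.
Unset Printing Implicit Defensive.

Local Open Scope classical_set_scope.

(* A relation from X to Y is a set (Y * X): its pairs have the form (output,
   input), so the library's composition r \; h of graphs is "r, then h" (the
   usual h o r), and the library's r^-1 is the transpose. *)
Definition graph (X Y : Type) (f : X -> Y) : set (Y * X) :=
  [set p | p.1 = f p.2].

Definition rel_prod (X Y X' Y' : Type) (h : set (Y * X)) (k : set (Y' * X')) :
    set ((Y * Y') * (X * X')) :=
  [set p | h (p.1.1, p.2.1) /\ k (p.1.2, p.2.2)].

Definition rel_image (X Y : Type) (h : set (Y * X)) (D : set X) : set Y :=
  [set y | exists2 x, D x & h (y, x)].

(* gmul (c, (a, b)) means c = a b. *)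
Record groupoid (T : Type) := Groupoid {
  gmul : set (T * (T * T));
  ginv : T -> T;
  gunits : set T;
  lproj : T -> T;
  rproj : T -> T;
  lproj_unit : forall a, gunits (lproj a);
  rproj_unit : forall a, gunits (rproj a);
  lproj_id : forall e, gunits e -> lproj e = e;
  rproj_id : forall e, gunits e -> rproj e = e;
  gmul_composable : forall a b,
    (exists c, gmul (c, (a, b))) <-> rproj a = lproj b;
  gmul_functional : forall a b c c',
    gmul (c, (a, b)) -> gmul (c', (a, b)) -> c = c';
  lproj_mul : forall a b c, gmul (c, (a, b)) -> lproj c = lproj a;
  rproj_mul : forall a b c, gmul (c, (a, b)) -> rproj c = rproj b;
  gmul_assoc : forall a b c ab bc d,
    gmul (ab, (a, b)) -> gmul (bc, (b, c)) ->
    gmul (d, (ab, c)) <-> gmul (d, (a, bc));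
  gmul_lunit : forall a, gmul (a, (lproj a, a));
  gmul_runit : forall a, gmul (a, (a, rproj a));
  gmul_rinv : forall a, gmul (lproj a, (a, ginv a));
  gmul_linv : forall a, gmul (rproj a, (ginv a, a)) }.

(* The projections are determined by the triple (gmul, ginv, gunits), so
   uniqueness of a [groupoid T] is uniqueness of that triple. *)
Lemma groupoid_eq (T : Type) (G H : groupoid T) :
  gmul G = gmul H -> ginv G = ginv H -> gunits G = gunits H -> G = H.
Proof.
move=> eqm eqi equ.
have eql : lproj G = lproj H.
  apply/funext => a; apply: (@gmul_functional _ G a (ginv G a)).
    exact: gmul_rinv.
  by rewrite eqm eqi; exact: gmul_rinv.
have eqr : rproj G = rproj H.
  apply/funext => a; apply: (@gmul_functional _ G (ginv G a) a).
    exact: gmul_linv.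
  by rewrite eqm eqi; exact: gmul_linv.
case: G H eqm eqi equ eql eqr => [m i u l r ? ? ? ? ? ? ? ? ? ? ? ? ?]
  [m' i' u' l' r' ? ? ? ? ? ? ? ? ? ? ? ? ?] /= *.
by subst m' i' u' l' r'; congr Groupoid; exact: Prop_irrelevance.
Qed.

Definition left_fiber (T : Type) (G : groupoid T) (a : T) : set T :=
  lproj G @^-1` [set lproj G a].

Definition right_fiber (T : Type) (G : groupoid T) (a : T) : set T :=
  rproj G @^-1` [set rproj G a].

Record groupoid_morphism (T1 T2 : Type) (G1 : groupoid T1) (G2 : groupoid T2)
    (h : set (T2 * T1)) : Prop := GroupoidMorphism {
  morphism_mul : (gmul G1 \; h = rel_prod h h \; gmul G2)%relation;
  morphism_inv : (graph (ginv G1) \; h = h \; graph (ginv G2))%relation;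
  morphism_units : rel_image h (gunits G1) = gunits G2 }.

Definition groupoid_monomorphism (T1 T2 : Type) (G1 : groupoid T1)
    (G2 : groupoid T2) (h : set (T2 * T1)) : Prop :=
  groupoid_morphism G1 G2 h /\
  forall (S : Type) (D : groupoid S) (f g : set (T1 * S)),
    groupoid_morphism D G1 f -> groupoid_morphism D G1 g ->
    (f \; h = g \; h)%relation -> f = g.

Record groupoid_automorphism (T : Type) (G : groupoid T) (phi : T -> T) :
    Prop := GroupoidAutomorphism {
  automorphism_bij : bijective phi;
  automorphism_units : phi @` gunits G = gunits G;
  automorphism_inv : phi \o ginv G = ginv G \o phi;
  automorphism_mul : (gmul G \; graph phi =
    rel_prod (graph phi) (graph phi) \; gmul G)%relation }.

Record automorphism_group (T : Type) (G : groupoid T)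
    (Phi : set (T -> T)) : Prop := AutomorphismGroup {
  autgroup_aut : forall phi, Phi phi -> groupoid_automorphism G phi;
  autgroup_id : Phi id;
  autgroup_comp : forall phi psi, Phi phi -> Phi psi -> Phi (phi \o psi);
  autgroup_inv : forall phi, Phi phi ->
    exists psi, [/\ Phi psi, cancel phi psi & cancel psi phi] }.

Definition orbit (T : Type) (Phi : set (T -> T)) (a : T) : set T :=
  [set phi a | phi in Phi].

Definition orbit_space (T : Type) (Phi : set (T -> T)) : Type :=
  set_type (range (orbit Phi)).

Definition orbit_proj (T : Type) (Phi : set (T -> T)) (a : T) :
    orbit_space Phi :=
  exist _ (orbit Phi a) (mem_set (imageT (orbit Phi) a)).

(* Main.v *)
Require Import Defs.
From mathcomp Require Import all_boot.
From mathcomp Require Import boolp classical_sets.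

(** Write [pi a] for the orbit of [a] and [pi^T] for the transposed graph of
    [pi].  Read pointwise, the three equations that make [pi^T] a morphism say
    that an orbit [pi c] is a product of the orbits [x] and [y] exactly when
    [c] is a product of a member of [x] and a member of [y], that the inverse
    of [pi a] is [pi (a^-1)], and that [pi c] is a unit exactly when [c] is.
    As [pi] is onto, they prescribe the structure on the orbits, which gives
    uniqueness ([morphism_transposeP]); what has to be proved is that the
    prescribed structure is a groupoid.

    The assumption on the group says that an automorphism in it is determined
    at [a] by its value at the left unit of [a] ([eq_phi_lproj]).  So if the
    right unit of [a] and the left unit of [b] lie in the same orbit, the
    translate of [b] that can be multiplied by [a] is unique: once a
    representative of one factor has been chosen, the product of two orbits is
    computed in the original groupoid ([quot_mul_liftl]), and it is a single
    orbit ([quot_mulE]).  Two products of orbits with a common factor can be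
    lifted to products with a common factor, so associativity descends; the
    other axioms are read off on representatives.

    Finally [pi^T] is a monomorphism because its transpose [pi] is onto: a
    relation [f] into the orbits is recovered from its composite with
    [pi^T]. *)

Set Implicit Arguments.
Unset Strict Implicit.
Unset Printing Implicit Defensive.

Local Open Scope classical_set_scope.

(** * Automorphisms *)

Section Automorphism.
Variables (T : Type) (G : groupoid T) (phi : T -> T).
Hypothesis phi_aut : groupoid_automorphism G phi.

Lemma aut_mul a b c : gmul G (c, (a, b)) -> gmul G (phi c, (phi a, phi b)).
Proof.
move=> mabc.
have : (gmul G \; graph phi)%relation (phi c, (a, b)) by exists c.
by rewrite (automorphism_mul phi_aut) => -[[u v] /= muv [/= <- <-]].
Qed.

Lemma aut_inv a : phi (ginv G a) = ginv G (phi a).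
Proof. by have /(congr1 (@^~ a)) := automorphism_inv phi_aut. Qed.

Lemma aut_unit e : gunits G e -> gunits G (phi e).
Proof. by move=> Ge; rewrite -(automorphism_units phi_aut); exists e. Qed.

(** [phi (lproj a)] is a unit that can be multiplied by [phi a] on its right,
    and the left unit of [phi a] is the only one. *)
Lemma aut_lproj a : phi (lproj G a) = lproj G (phi a).
Proof.
rewrite -[LHS](rproj_id (aut_unit (lproj_unit G a))).
by apply/gmul_composable; exists (phi a); exact/aut_mul/gmul_lunit.
Qed.

Lemma aut_rproj a : phi (rproj G a) = rproj G (phi a).
Proof.
rewrite -[LHS](lproj_id (aut_unit (rproj_unit G a))); apply/esym.
by apply/gmul_composable; exists (phi a); exact/aut_mul/gmul_runit.
Qed.

End Automorphism.

(** * The structure induced on the orbits *)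

Section Quotient.
Variables (T : Type) (G : groupoid T) (Phi : set (T -> T)).
Hypothesis Phi_group : automorphism_group G Phi.

Let Q := orbit_space Phi.
Let pi : T -> Q := orbit_proj Phi.

Lemma orbit_proj_surj (x : Q) : exists a, x = pi a.
Proof.
case: x => A hA; have [a _ aA] := set_mem hA.
by exists a; apply: val_inj; rewrite /= aA.
Qed.

Lemma orbit_projP a b : pi a = pi b <-> exists2 phi, Phi phi & b = phi a.
Proof.
split=> [/(congr1 val) /= ab|[phi Pphi ->]].
  have : Defs.orbit Phi b b by exists id => //; exact: autgroup_id Phi_group.
  by rewrite -ab => -[phi Pphi <-]; exists phi.
have [psi [Ppsi phiK psiK]] := autgroup_inv Phi_group Pphi.
apply: val_inj; apply/seteqP; split=> _ [chi Pchi <-].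
  exists (chi \o psi); last by rewrite /= phiK.
  exact (autgroup_comp Phi_group Pchi Ppsi).
exists (chi \o phi) => //.
exact (autgroup_comp Phi_group Pchi Pphi).
Qed.

Lemma orbit_proj_phi phi a : Phi phi -> pi (phi a) = pi a.
Proof. by move=> Pphi; apply/esym/orbit_projP; exists phi. Qed.

Definition orbit_repr (x : Q) : T := projT1 (cid (orbit_proj_surj x)).

Lemma orbit_reprK x : pi (orbit_repr x) = x.
Proof. by rewrite /orbit_repr; case: cid. Qed.

(** Only meant for [f] commuting with the group, when the chosen representative
    does not matter ([orbit_mapE]). *)
Definition orbit_map (f : T -> T) (x : Q) : Q := pi (f (orbit_repr x)).

Lemma orbit_mapE f :
    (forall phi a, Phi phi -> phi (f a) = f (phi a)) ->
  forall a, orbit_map f (pi a) = pi (f a).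
Proof.
move=> fphi a; rewrite /orbit_map.
have /esym/orbit_projP[phi Pphi ->] := orbit_reprK (pi a).
by rewrite -fphi // orbit_proj_phi.
Qed.

Definition quot_mul : set (Q * (Q * Q)) :=
  [set p | exists a b c,
    [/\ gmul G (c, (a, b)), p.1 = pi c, p.2.1 = pi a & p.2.2 = pi b]].

Definition quot_units : set Q := pi @` gunits G.

Definition quot_inv : Q -> Q := orbit_map (ginv G).
Definition quot_lproj : Q -> Q := orbit_map (lproj G).
Definition quot_rproj : Q -> Q := orbit_map (rproj G).

Lemma quot_invE a : quot_inv (pi a) = pi (ginv G a).
Proof.
by apply: orbit_mapE => phi b /(autgroup_aut Phi_group) /aut_inv.
Qed.

Lemma quot_lprojE a : quot_lproj (pi a) = pi (lproj G a).
Proof.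
by apply: orbit_mapE => phi b /(autgroup_aut Phi_group) /aut_lproj.
Qed.

Lemma quot_rprojE a : quot_rproj (pi a) = pi (rproj G a).
Proof.
by apply: orbit_mapE => phi b /(autgroup_aut Phi_group) /aut_rproj.
Qed.

Lemma quot_mul_pi a b c : gmul G (c, (a, b)) -> quot_mul (pi c, (pi a, pi b)).
Proof. by move=> mabc; exists a, b, c. Qed.

Lemma autgroup_mul phi a b c :
  Phi phi -> gmul G (c, (a, b)) -> gmul G (phi c, (phi a, phi b)).
Proof. by move=> /(autgroup_aut Phi_group)/aut_mul; exact. Qed.

(** A representative of one entry of a product of orbits can be prescribed,
    because an automorphism moves a whole product in the original groupoid at
    once.  Here it is prescribed for the left factor; [quot_mul_lift] does the
    same for the product itself. *)
Lemma quot_mul_liftl z a y : quot_mul (z, (pi a, y)) ->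
  exists b c, [/\ gmul G (c, (a, b)), z = pi c & y = pi b].
Proof.
move=> [a0 [b [c [/= mabc -> /esym/orbit_projP[phi Pphi ->] ->]]]].
by exists (phi b), (phi c); rewrite !orbit_proj_phi //; split=> //;
  exact: autgroup_mul.
Qed.

Lemma quot_mul_lift c x y : quot_mul (pi c, (x, y)) ->
  exists a b, [/\ gmul G (c, (a, b)), x = pi a & y = pi b].
Proof.
move=> [a [b [c0 [/= mabc /esym/orbit_projP[phi Pphi ->] -> ->]]]].
by exists (phi a), (phi b); rewrite !orbit_proj_phi //; split=> //;
  exact: autgroup_mul.
Qed.

Lemma quot_unit_lift a : quot_units (pi a) -> gunits G a.
Proof.
move=> [e Ge /orbit_projP[phi Pphi ->]].
exact: aut_unit (autgroup_aut Phi_group Pphi) _ Ge.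
Qed.

(** Since [pi] is onto, evaluating the three equations at representatives reads
    off the structure of [H].  Conversely the equations hold because the
    structure on the orbits is saturated: what holds for one member of an orbit
    lifts to every other member. *)
Lemma morphism_transposeP (H : groupoid Q) :
  groupoid_morphism H G (graph pi)^-1%relation <->
  [/\ gmul H = quot_mul, ginv H = quot_inv & gunits H = quot_units].
Proof.
split=> [[Hm Hi Hu]|[Hm Hi Hu]].
  split.
  - apply/seteqP; split=> -[z [x y]] => [|[a [b [c [/= + -> -> ->]]]]].
      have [c ->] := orbit_proj_surj z => mxyc.
      have : (gmul H \; (graph pi)^-1)%relation (c, (x, y)) by exists (pi c).
      rewrite Hm => -[[a b] /= mabc []]; rewrite /graph /= => -> ->.
      exact: quot_mul_pi.
    move=> mabc.
    have : (rel_prod (graph pi)^-1 (graph pi)^-1 \; gmul G)%relation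
      (c, (pi a, pi b)) by exists (a, b).
    by rewrite -Hm => -[w]; rewrite /graph /= => ->.
  - apply/funext => x; have [a ->] := orbit_proj_surj x.
    have : ((graph pi)^-1 \; graph (ginv G))%relation (ginv G a, pi a).
      by exists a.
    by rewrite -Hi quot_invE => -[z]; rewrite /graph /= => -> <-.
  - apply/seteqP; split=> [x|_ [e Ge <-]].
      have [e ->] := orbit_proj_surj x => He; exists e => //.
      by rewrite -Hu; exists (pi e).
    by move: Ge; rewrite -Hu => -[x Hx]; rewrite /graph /= => <-.
split.
- apply/seteqP; split=> -[c [x y]] [].
    move=> z; rewrite /graph /= => ->; rewrite Hm => /quot_mul_lift.
    by move=> [a [b [mabc -> ->]]]; exists (a, b).
  move=> [a b] /= mabc []; rewrite /graph /= => -> ->.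
  by exists (pi c); rewrite // Hm; exact: quot_mul_pi.
- apply/seteqP; split=> -[c x] []; rewrite /graph /=.
    have [a ->] := orbit_proj_surj x => _ ->.
    rewrite Hi quot_invE => /esym/orbit_projP[phi Pphi ->].
    exists (phi a); last by rewrite /= orbit_proj_phi.
    exact: aut_inv (autgroup_aut Phi_group Pphi) a.
  by move=> a -> ->; exists (pi (ginv G a)); rewrite //= Hi quot_invE.
- rewrite Hu; apply/seteqP; split=> [e []|e Ge].
    by move=> x + xe; rewrite (xe : x = pi e); exact: quot_unit_lift.
  by exists (pi e) => //; exists e.
Qed.

(** * Groupoid axioms for the orbits *)

Hypothesis Phi_fix : forall phi e, Phi phi -> gunits G e -> phi e = e ->
  forall a, (left_fiber G e `|` right_fiber G e) a -> phi a = a.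

Lemma eq_phi_lproj phi a : Phi phi -> lproj G (phi a) = lproj G a -> phi a = a.
Proof.
move=> Pphi; rewrite -(aut_lproj (autgroup_aut Phi_group Pphi)) => fixl.
apply: (Phi_fix Pphi (lproj_unit G a) fixl); left.
by rewrite /left_fiber /= (lproj_id (lproj_unit G a)).
Qed.

Lemma composable a b c : gmul G (c, (a, b)) -> rproj G a = lproj G b.
Proof. by move=> mabc; apply/gmul_composable; exists c. Qed.

(** After lifting along [a], the second factor is a translate of [b] with the
    same left unit as [b], hence is [b]. *)
Lemma quot_mulE a b c z :
  gmul G (c, (a, b)) -> quot_mul (z, (pi a, pi b)) <-> z = pi c.
Proof.
move=> mabc; split=> [|->]; last exact: quot_mul_pi.
move=> /quot_mul_liftl[b' [c' [mabc' -> /orbit_projP[phi Pphi b'E]]]].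
have b'b : b' = b.
  rewrite b'E; apply: eq_phi_lproj => //.
  by rewrite -b'E -(composable mabc') (composable mabc).
by rewrite b'b in mabc'; rewrite (gmul_functional mabc mabc').
Qed.

Lemma quot_mul_composable x y :
  (exists z, quot_mul (z, (x, y))) <-> quot_rproj x = quot_lproj y.
Proof.
split=> [[_ [a [b [c [/= mabc _ -> ->]]]]]|].
  by rewrite quot_rprojE quot_lprojE (composable mabc).
have [a ->] := orbit_proj_surj x; have [b ->] := orbit_proj_surj y.
rewrite quot_rprojE quot_lprojE => /orbit_projP[phi Pphi].
rewrite (aut_rproj (autgroup_aut Phi_group Pphi)) => /esym/gmul_composable.
move=> [c mc]; exists (pi c); rewrite -(orbit_proj_phi a Pphi).
exact: quot_mul_pi.
Qed.

Lemma quot_mul_functional x y z z' :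
  quot_mul (z, (x, y)) -> quot_mul (z', (x, y)) -> z = z'.
Proof.
by move=> [a [b [c [/= mabc -> -> ->]]]] /(quot_mulE _ mabc) ->.
Qed.

(** The two given products share the factor [y]; lifted along it, they give
    three composable elements of the original groupoid, and both sides become
    the statement that [w] is the orbit of their product. *)
Lemma quot_mul_assoc x y z xy yz w :
    quot_mul (xy, (x, y)) -> quot_mul (yz, (y, z)) ->
  quot_mul (w, (xy, z)) <-> quot_mul (w, (x, yz)).
Proof.
move=> [a [b [ab [/= mab -> -> ->]]]] /quot_mul_liftl[c [bc [mbc -> ->]]].
have [d mabc_l] : exists d, gmul G (d, (ab, c)).
  by apply/gmul_composable; rewrite (rproj_mul mab) (composable mbc).
have mabc_r := (gmul_assoc d mab mbc).1 mabc_l.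
exact: iff_trans (quot_mulE _ mabc_l) (iff_sym (quot_mulE _ mabc_r)).
Qed.

Lemma quot_groupoid_exists : exists H : groupoid Q,
  [/\ gmul H = quot_mul, ginv H = quot_inv & gunits H = quot_units].
Proof.
unshelve eexists (@Groupoid Q quot_mul quot_inv quot_units quot_lproj quot_rproj
  _ _ _ _ quot_mul_composable _ _ _ quot_mul_assoc _ _ _ _) => //.
- move=> x; have [a ->] := orbit_proj_surj x; rewrite quot_lprojE.
  by exists (lproj G a) => //; exact: lproj_unit.
- move=> x; have [a ->] := orbit_proj_surj x; rewrite quot_rprojE.
  by exists (rproj G a) => //; exact: rproj_unit.
- by move=> _ [e Ge <-]; rewrite quot_lprojE lproj_id.
- by move=> _ [e Ge <-]; rewrite quot_rprojE rproj_id.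
- by move=> x y z z'; exact: quot_mul_functional.
- move=> _ _ _ [a [b [c [/= mabc -> -> _]]]].
  by rewrite !quot_lprojE (lproj_mul mabc).
- move=> _ _ _ [a [b [c [/= mabc -> _ ->]]]].
  by rewrite !quot_rprojE (rproj_mul mabc).
- move=> x; have [a ->] := orbit_proj_surj x; rewrite quot_lprojE.
  exact/quot_mul_pi/gmul_lunit.
- move=> x; have [a ->] := orbit_proj_surj x; rewrite quot_rprojE.
  exact/quot_mul_pi/gmul_runit.
- move=> x; have [a ->] := orbit_proj_surj x; rewrite quot_lprojE quot_invE.
  exact/quot_mul_pi/gmul_rinv.
- move=> x; have [a ->] := orbit_proj_surj x; rewrite quot_rprojE quot_invE.
  exact/quot_mul_pi/gmul_linv.
Qed.

End Quotient.

(** Composing with the transpose of a surjective map can be undone: [f] relates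
    [p x] to [s] exactly when the composite relates [x] to [s]. *)
Lemma comp_transpose_inj (X Y S : Type) (p : X -> Y) (f g : set (Y * S)) :
    (forall y, exists x, y = p x) ->
    (f \; (graph p)^-1 = g \; (graph p)^-1)%relation -> f = g.
Proof.
move=> p_surj fg; apply/seteqP; split=> -[y s]; have [x ->] := p_surj y => h.
  have : (f \; (graph p)^-1)%relation (x, s) by exists (p x).
  by rewrite fg => -[y']; rewrite /graph /= => ->.
have : (g \; (graph p)^-1)%relation (x, s) by exists (p x).
by rewrite -fg => -[y']; rewrite /graph /= => ->.
Qed.

Theorem proposition2p5 (T : Type) (G : groupoid T) (Phi : set (T -> T))
    (Phi_group : automorphism_group G Phi)
    (Phi_fix : forall (phi : T -> T) (e : T), Phi phi -> gunits G e ->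
      phi e = e ->
      forall a : T, (left_fiber G e `|` right_fiber G e) a -> phi a = a) :
  exists Gt : groupoid (orbit_space Phi),
    unique (fun H : groupoid (orbit_space Phi) =>
      groupoid_morphism H G (graph (orbit_proj Phi))^-1%relation) Gt /\
    groupoid_monomorphism Gt G (graph (orbit_proj Phi))^-1%relation.
Proof.
have [H HE] := quot_groupoid_exists Phi_group Phi_fix.
have Hmor := (morphism_transposeP Phi_group H).2 HE.
exists H; split; split=> //.
  move=> K /(morphism_transposeP Phi_group)[Km Ki Ku].
  by case: HE => Hm Hi Hu; apply: groupoid_eq; rewrite ?Km ?Ki ?Ku.
move=> S D f g _ _; apply: comp_transpose_inj.
exact: orbit_proj_surj.
Qed.
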